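(* There is an absolute constant $C>0$ such that the following holds. For any $\varepsilon>0$ there is a $\delta=\delta(\varepsilon)\ge 2^{-C/\varepsilon}$ (i.e. $\delta=2^{-O(1/\varepsilon)}$) such that for every bipartite graph $G$ with bipartition $X\cup Y$, $|X|=n$ and $|Y|=2n$, if $\mathrm{im}(G)<(1-\varepsilon)n$, then $\log\mathrm{mis}(G)<(1-\delta)n$.
   Context: $\mathrm{mis}(G)$ denotes the number of maximal independent sets of $G$, and $\log=\log_2$. An induced matching of $G$ is an induced subgraph of $G$ that is a matching; $\mathrm{im}(G)$ is the number of edges in a largest induced matching of $G$. *)

(* Defs.v *)
From mathcomp Require Import all_boot all_order all_algebra.
From mathcomp Require Import reals exp.

Set Implicit Arguments.
Unset Strict Implicit.
Unset Printing Implicit Defensive.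

Import Order.TTheory GRing.Theory Num.Theory.
Local Open Scope ring_scope.

Definition simple_graph (T : finType) (e : rel T) : Prop :=
  symmetric e /\ irreflexive e.

Definition bipartition (T : finType) (e : rel T) (X Y : {set T}) : Prop :=
  [/\ X :|: Y = [set: T], [disjoint X & Y] &
      forall x y, e x y ->
        (x \in X) && (y \in Y) || (x \in Y) && (y \in X)].

Definition independent (T : finType) (e : rel T) (S : {set T}) : bool :=
  [forall x in S, forall y in S, ~~ e x y].

Definition mis (T : finType) (e : rel T) : nat :=
  #|[set S : {set T} | maxset (independent e) S]|.

Definition induced_edges (T : finType) (e : rel T) (S : {set T}) :
    {set {set T}} :=
  [set [set x; y] | x in S, y in S & e x y].

(* The subgraph induced on S is a matching: its edges are pairwise disjoint
   and cover S, so no isolated vertices are allowed in S. *)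
Definition induced_matching (T : finType) (e : rel T) (S : {set T}) : bool :=
  partition (induced_edges e S) S.

Definition im (T : finType) (e : rel T) : nat :=
  \max_(S : {set T} | induced_matching e S) #|induced_edges e S|.

Definition log2 (R : realType) (x : R) : R := ln x / ln 2.

(* Main.v *)
Require Import Defs.
From mathcomp Require Import all_boot all_order all_algebra.
From mathcomp Require Import reals exp lra zify.

(** A maximal independent set S is determined by the trace N(S n X) n Y, so one
bounds the number t(X, Y) of distinct traces N(A) n Y with A a subset of X.
Put K = O(1/eps), with K >= 7/eps, and compare t(X, Y) with
2^|X| th^(K (|X| - im) - 3 |Y|), where th = 1 - 2^-K / K^2.

If some x in X has at least K neighbours in Y, split according to whether x
is in A: t(X, Y) <= t(X - x, Y - N(x)) + t(X - x, Y). Each branch loses one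
unit of |X| - im, but the first one also loses K vertices of Y, which
outweighs this loss.

Otherwise, as long as |X| > im, some z in X has no private neighbour in Y
(the vertices with private neighbours yield an induced matching). Choosing
another neighbour in X for each neighbour of z gives a block P of at most K
vertices, containing z, with N(P) = N(P - z) in Y. Hence one of the 2^|P|
patterns of A on P is redundant and t(X, Y) <= (2^|P| - 1) t(X - P, Y).

With |X| = n, |Y| = 2n and |X| - im > eps n, the exponent of th is at least
7n - 6n = n, so mis(G) <= (2 th)^n. *)

Set Implicit Arguments.
Unset Strict Implicit.
Unset Printing Implicit Defensive.

Import Order.TTheory GRing.Theory Num.Theory.
Local Open Scope ring_scope.

(** * Traces of neighbourhoods and the two recursions for their number *)

Section Traces.
Variables (T : finType) (e : rel T).
Implicit Types (A B P Q X Y S : {set T}) (x y z : T).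

Definition nbr A : {set T} := [set y | [exists x in A, e x y]].

Definition traces X Y : {set {set T}} := [set nbr A :&: Y | A in powerset X].

Definition has_private X Y x : bool :=
  [exists y in Y, e x y && [forall x' in X, e x' y ==> (x' == x)]].

Lemma nbrP A y : reflect (exists2 x, x \in A & e x y) (y \in nbr A).
Proof. by rewrite inE; apply: exists_inP. Qed.

Lemma nbrU A B : nbr (A :|: B) = nbr A :|: nbr B.
Proof.
apply/setP=> y; rewrite in_setU; apply/nbrP/orP.
  by case=> x /setUP[xA|xB] xy; [left|right]; apply/nbrP; exists x.
by case=> /nbrP[x xA xy]; exists x => //; rewrite inE xA ?orbT.
Qed.

Lemma card_traces_le X Y : (#|traces X Y| <= 2 ^ #|X|)%N.
Proof. by rewrite -card_powerset leq_imset_card. Qed.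

(** If [x] lies in [A], the trace contains all of N(x) in [Y], so only its part outside N(x) can
    vary, and that part depends on [A :\ x] alone. *)
Lemma card_traces_branch X Y x : x \in X ->
  (#|traces X Y| <= #|traces (X :\ x) (Y :\: nbr [set x])|
                    + #|traces (X :\ x) Y|)%N.
Proof.
move=> xX; set N := nbr [set x].
pose h B := (N :&: Y) :|: B.
apply: (@leq_trans #|h @: traces (X :\ x) (Y :\: N) :|: traces (X :\ x) Y|).
  apply: subset_leq_card; apply/subsetP=> _ /imsetP[A + ->]; rewrite powersetE => AX.
  have DX : A :\ x \in powerset (X :\ x) by rewrite powersetE setSD.
  rewrite inE; have [xA|xA] := boolP (x \in A); last first.
    apply/orP; right; apply/imsetP; exists A => //.
    rewrite powersetE; apply/subsetP=> u uA; rewrite !inE (subsetP AX) // andbT.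
    by apply: contraNneq xA => <-.
  apply/orP; left; apply/imsetP; exists (nbr (A :\ x) :&: (Y :\: N)).
    exact: imset_f.
  rewrite /h -{1}(setD1K xA) nbrU -/N; apply/setP=> u.
  rewrite !in_setI !in_setU !in_setI in_setD.
  by case: (u \in N); case: (u \in Y); rewrite ?andbT ?andbF.
by apply: leq_trans (leq_card_setU _ _) _; rewrite leq_add2r leq_imset_card.
Qed.

(** Replacing the pattern [Q2] of [A] on [P] by [Q1] leaves the trace unchanged, so patterns other
    than [Q2], joined with traces of [X :\: P], already give every trace. *)
Lemma card_traces_block X Y P Q1 Q2 :
    P \subset X -> Q1 \subset P -> Q2 \subset P -> Q1 != Q2 ->
    nbr Q1 :&: Y = nbr Q2 :&: Y ->
  (#|traces X Y| <= (2 ^ #|P|).-1 * #|traces (X :\: P) Y|)%N.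
Proof.
move=> PX Q1P Q2P neqQ eqQ.
pose D := setX (powerset P :\ Q2) (traces (X :\: P) Y).
pose h (p : {set T} * {set T}) := (nbr p.1 :&: Y) :|: p.2.
have <- : #|D| = ((2 ^ #|P|).-1 * #|traces (X :\: P) Y|)%N.
  by rewrite cardsX -card_powerset (cardsD1 Q2 (powerset P)) powersetE Q2P.
apply: leq_trans (leq_imset_card h (pred_of_set D)).
apply: subset_leq_card; apply/subsetP=> _ /imsetP[A + ->]; rewrite powersetE => AX.
pose Q := if A :&: P == Q2 then Q1 else A :&: P.
have eqA : nbr Q :&: Y = nbr (A :&: P) :&: Y by rewrite /Q; case: eqP => // ->.
apply/imsetP; exists (Q, nbr (A :\: P) :&: Y).
  rewrite in_setX in_setD1 powersetE /= -andbA /Q; apply/and3P; split; last 1 first.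
  - by apply: imset_f; rewrite powersetE setSD.
  - by case: ifP => // ->.
  - by case: ifP => // _; rewrite subsetIr.
by rewrite /h /= eqA -setIUl -nbrU setID.
Qed.

Lemma exists_block X Y z : z \in X -> ~~ has_private X Y z ->
  exists P, [/\ z \in P, P \subset X, (#|P| <= #|nbr [set z] :&: Y|.+1)%N &
                nbr P :&: Y = nbr (P :\ z) :&: Y].
Proof.
move=> zX npr.
(* The default [z] is never taken on neighbours of [z] in [Y]: such a neighbour would be private to
   [z]. *)
pose other y := odflt z [pick x in X | (x != z) && e x y].
have otherP y : y \in nbr [set z] :&: Y ->
    [/\ other y \in X, other y != z & e (other y) y].
  case/setIP=> /nbrP[_ /set1P-> zy] yY; rewrite /other.
  case: pickP => [x /and3P[]//|none]; case/negP: npr.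
  apply/exists_inP; exists y => //; rewrite zy; apply/forall_inP=> x xX.
  by apply/implyP=> xy; have:= none x; rewrite /= xX xy andbT => /negbFE.
pose O := other @: (nbr [set z] :&: Y).
have zO : z \notin O.
  by apply/imsetP=> -[y /otherP[_ + _]] zy; rewrite -zy eqxx.
exists (z |: O); split.
- exact: setU11.
- rewrite subUset sub1set zX; apply/subsetP=> _ /imsetP[y yN ->].
  by case: (otherP y yN).
- by rewrite cardsU1 zO add1n ltnS leq_imset_card.
rewrite setU1K // nbrU setIUl; apply/setUidPr/subsetP=> y yN.
have [_ _ oy] := otherP y yN; case/setIP: (yN) => _ yY.
by rewrite inE yY andbT; apply/nbrP; exists (other y) => //; apply: imset_f.
Qed.

(** * Links with maximal independent sets and induced matchings *)

Lemma mis_le_traces X Y : simple_graph e -> bipartition e X Y ->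
  (mis e <= #|traces X Y|)%N.
Proof.
move=> [sym irr] [XYT XY XYe].
have indepP S : reflect {in S &, forall x y, ~~ e x y} (independent e S).
  apply: (iffP forall_inP) => [H x y xS yS|H x xS].
    by move/forall_inP: (H x xS); apply.
  by apply/forall_inP=> y yS; apply: H.
have maxS S x : maxset (independent e) S -> x \notin S -> exists2 y, y \in S & e x y.
  case/maxsetP=> /indepP indS maxS xS.
  apply/exists_inP; apply: contraT; rewrite negb_exists_in => /forall_inP nx.
  suff: x |: S = S by move=> eqS; rewrite -eqS setU11 in xS.
  apply: maxS; last exact: subsetUr.
  apply/indepP=> u v /setU1P[->|uS] /setU1P[->|vS]; rewrite ?irr ?nx //.
    by rewrite sym nx.
  exact: indS.
have mem_max S x : maxset (independent e) S -> (x \in S) = (x \notin nbr S).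
  move=> mS; apply/idP/idP=> [xS|].
    apply/nbrP=> -[y yS yx]; case/maxsetP: mS => /indepP/(_ y x yS xS).
    by rewrite yx.
  apply: contraR => /(maxS _ _ mS)[y yS xy]; apply/nbrP; exists y => //.
  by rewrite sym.
have nbr_side A B S z : [disjoint A & B] -> z \in B ->
    (forall x, e x z -> (x \in A) && (z \in B) || (x \in B) && (z \in A)) ->
    (z \in nbr S) = (z \in nbr (S :&: A)).
  move=> AB zB eAB; apply/nbrP/nbrP=> -[x xS xz]; exists x => //; last first.
    by case/setIP: xS.
  rewrite inE xS; have /orP[/andP[]//|/andP[_ zA]] := eAB x xz.
  by rewrite (disjointFr AB zA) in zB.
have nbrY S y : y \in Y -> (y \in nbr S) = (y \in nbr (S :&: X)).
  by move=> yY; apply: (nbr_side X Y) => // x; apply: XYe.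
have nbrX S x : x \in X -> (x \in nbr S) = (x \in nbr (S :&: Y)).
  move=> xX; apply: (nbr_side Y X) => // [|y /XYe]; first by rewrite disjoint_sym.
  by rewrite orbC.
(* By maximality a vertex lies outside S exactly when it has a neighbour in S. So [h S] is the
   complement of S in [Y], and S in [Y] in turn determines S in [X]. *)
pose h S := nbr (S :&: X) :&: Y.
rewrite /mis -(card_in_imset (f := h)).
  apply/subset_leq_card/subsetP=> _ /imsetP[S _ ->].
  by apply: imset_f; rewrite powersetE subsetIr.
move=> S1 S2; rewrite !inE => m1 m2 /setP eqh.
have eqY : S1 :&: Y = S2 :&: Y.
  apply/setP=> y; rewrite !in_setI; have [yY|] := boolP (y \in Y); last by rewrite !andbF.
  rewrite (mem_max _ _ m1) (mem_max _ _ m2) (nbrY S1) // (nbrY S2) //.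
  by have:= eqh y; rewrite !in_setI yY !andbT => ->.
apply/setP=> z; have: z \in X :|: Y by rewrite XYT.
case/setUP=> [zX|zY]; last by have/setP/(_ z) := eqY; rewrite !in_setI zY !andbT.
by rewrite (mem_max _ _ m1) (mem_max _ _ m2) (nbrX S1) // (nbrX S2) // eqY.
Qed.

(** Joining each such vertex to one of its private neighbours gives an induced matching: a further
    edge would have to cross between the sides, which privacy forbids. *)
Lemma card_private_le_im X Y X' Y' : simple_graph e -> bipartition e X Y ->
  X' \subset X -> Y' \subset Y ->
  (#|[set x in X' | has_private X' Y' x]| <= im e)%N.
Proof.
move=> [sym irr] [_ XY XYe] X'X Y'Y; set P := [set x in X' | _].
pose w x := odflt x
  [pick y in Y' | e x y && [forall x' in X', e x' y ==> (x' == x)]].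
have wP x : x \in P -> [/\ w x \in Y', e x (w x) &
    forall x', x' \in X' -> e x' (w x) -> x' = x].
  rewrite inE => /andP[_ /exists_inP[y yY yP]]; rewrite /w.
  case: pickP => [u /and3P[uY xu /forall_inP uP]|none]; last first.
    by have:= none y; rewrite /= yY yP.
  by split=> // x' x'X x'u; apply/eqP; apply: (implyP (uP _ x'X)).
have PX x : x \in P -> x \in X' by rewrite inE => /andP[].
have noXX x y : x \in X -> y \in X -> ~~ e x y.
  move=> xX yX; apply/negP=> /XYe.
  by rewrite (disjointFr XY xX) (disjointFr XY yX) andbF.
have noYY x y : x \in Y -> y \in Y -> ~~ e x y.
  move=> xX yX; apply/negP=> /XYe.
  by rewrite (disjointFl XY xX) (disjointFl XY yX) andbF.
have PinX x : x \in P -> x \in X by move/PX/(subsetP X'X).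
have winY x : x \in P -> w x \in Y by case/wP=> /(subsetP Y'Y).
have neqw x x' : x \in P -> x' \in P -> x != w x'.
  move=> xP x'P; apply: contraTneq (PinX x xP) => ->.
  by rewrite (disjointFl XY (winY _ x'P)).
have injw : {in P &, injective w}.
  move=> x x' xP x'P eqw; have [_ _] := wP _ x'P; apply; first exact: PX.
  by rewrite -eqw; case: (wP _ xP).
pose M := P :|: w @: P.
have edgesE : induced_edges e M = [set [set x; w x] | x in P].
  apply/setP=> E; apply/imset2P/imsetP=> [[u v uM]|[x xP ->]]; last first.
    exists x (w x) => //; first by rewrite in_setU xP.
    by rewrite inE in_setU imset_f ?orbT //; case: (wP x xP).
  rewrite inE => /andP[vM uv] ->.
  case/setUP: uM uv => [uP|/imsetP[x xP ->]] uv.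
    case/setUP: vM uv => [vP|/imsetP[x xP ->]] uv.
      by rewrite (negPf (noXX _ _ (PinX _ uP) (PinX _ vP))) in uv.
    by exists x => //; have [_ _ /(_ u (PX _ uP) uv) ->] := wP x xP.
  case/setUP: vM uv => [vP|/imsetP[x' x'P ->]] uv.
    exists x => //; rewrite setUC; rewrite sym in uv.
    by have [_ _ /(_ v (PX _ vP) uv) ->] := wP x xP.
  by rewrite (negPf (noYY _ _ (winY _ xP) (winY _ x'P))) in uv.
have mem_edge x z : x \in P -> z \in P -> (z \in [set x; w x]) = (z == x).
  by move=> xP zP; rewrite !inE (negPf (neqw z x zP xP)) orbF.
have mem_edgew x z : x \in P -> z \in P -> (w z \in [set x; w x]) = (z == x).
  move=> xP zP; rewrite !inE eq_sym (negPf (neqw x z xP zP)) /=.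
  by apply/eqP/eqP=> [/(injw _ _ zP xP)|->].
have match_M : induced_matching e M.
  rewrite /induced_matching edgesE; apply/and3P; split.
  - rewrite eqEsubset; apply/andP; split; apply/subsetP=> z.
      case/bigcupP=> _ /imsetP[x xP ->] /set2P[]->; rewrite in_setU ?xP //.
      by apply/orP; right; apply: imset_f.
    case/setUP=> [zP|/imsetP[x xP ->]]; apply/bigcupP.
      by exists [set z; w z]; [apply: (imset_f (fun x => [set x; w x]))|apply: set21].
    by exists [set x; w x]; [apply: (imset_f (fun x => [set x; w x]))|apply: set22].
  - apply/trivIsetP=> _ _ /imsetP[x xP ->] /imsetP[x' x'P ->] neq.
    have {}neq : x != x' by apply: contraNneq neq => ->.
    rewrite disjoint_subset; apply/subsetP=> z /set2P[]->; rewrite inE /=.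
      by rewrite mem_edge.
    by rewrite mem_edgew.
  - by apply/imsetP=> -[x _ /setP/(_ x)]; rewrite !inE eqxx.
have <- : #|induced_edges e M| = #|P|.
  rewrite edgesE card_in_imset // => x x' xP x'P /setP/(_ x).
  by rewrite !mem_edge // eqxx => /esym/eqP.
exact: (@leq_bigmax_cond _ (induced_matching e) (fun S => #|induced_edges e S|)).
Qed.

End Traces.

(** * The weighted bound, by strong induction on the size of [X'] *)

Lemma card_traces_bound (R : realFieldType) (T : finType) (e : rel T)
    (X Y X' Y' : {set T}) (K : nat) (th : R) :
    simple_graph e -> bipartition e X Y -> X' \subset X -> Y' \subset Y ->
    0 < th -> th <= 1 ->
    1 + th ^+ (3 * K) <= 2 * th ^+ K -> 1 - (2 ^+ K)^-1 <= th ^+ (K * K) ->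
  #|traces e X' Y'|%:R * th ^+ (3 * #|Y'|)
    <= 2 ^+ #|X'| * th ^+ (K * (#|X'| - im e)).
Proof.
move=> Ge XYe + + th0 th1 hubK blockK.
have th_anti m k : (m <= k)%N -> th ^+ k <= th ^+ m.
  by move=> mk; apply: ler_wiXn2l => //; apply: ltW.
have th_ge0 k : 0 <= th ^+ k by rewrite exprn_ge0 ?ltW.
have [k] := ubnP #|X'|; elim: k => // k IH in X' Y' * => + X'X Y'Y.
rewrite ltnS => leXk.
have [/exists_inP[x xX' hub]|nohub] :=
    boolP [exists x in X', (K <= #|nbr e [set x] :&: Y'|)%N].
  have cX : #|X'| = #|X' :\ x|.+1 by rewrite (cardsD1 x) xX'.
  have ltXk : (#|X' :\ x| < k)%N by rewrite -cX.
  have X1X : X' :\ x \subset X by apply: subset_trans X'X; apply: subsetDl.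
  have Y1Y : Y' :\: nbr e [set x] \subset Y by apply: subset_trans Y'Y; apply: subsetDl.
  have IH1 := IH _ _ ltXk X1X Y1Y; have IH2 := IH _ _ ltXk X1X Y'Y.
  have tr : #|traces e X' Y'|%:R <= #|traces e (X' :\ x) (Y' :\: nbr e [set x])|%:R
      + #|traces e (X' :\ x) Y'|%:R :> R.
    by rewrite -natrD ler_nat card_traces_branch.
  (* In the branch with [x] in A at least [K] vertices of [Y'] disappear, which gains a factor
     [th ^+ (3 * K)]. By [hubK] the two branches together then cost at most [2 * th ^+ K], where
     [th ^+ K] pays for the loss of one unit of [#|X'| - im e]. *)
  have cY : (3 * #|Y'| = 3 * #|Y' :\: nbr e [set x]| + 3 * #|nbr e [set x] :&: Y'|)%N.
    by rewrite -mulnDr addnC setIC cardsID.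
  set d := #|X' :\ x| in cX IH1 IH2.
  have yes : #|traces e (X' :\ x) (Y' :\: nbr e [set x])|%:R * th ^+ (3 * #|Y'|)
      <= 2 ^+ d * th ^+ (K * (d - im e)) * th ^+ (3 * K).
    rewrite cY exprD mulrA; apply: ler_pM => //; first by rewrite mulr_ge0.
    by apply: th_anti; rewrite leq_mul2l hub.
  apply: le_trans (ler_wpM2r (th_ge0 _) tr) _; rewrite mulrDl.
  apply: le_trans (lerD yes IH2) _; rewrite -[X in _ + X]mulr1 -mulrDr [_ + 1]addrC.
  apply: le_trans (ler_wpM2l _ hubK) _; first by rewrite mulr_ge0 ?th_ge0 ?exprn_ge0.
  rewrite cX exprSr mulrACA -exprD; apply: ler_wpM2l.
    by rewrite mulr_ge0 ?th_ge0 ?exprn_ge0.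
  apply: th_anti; rewrite -[X in (_ + X)%N]muln1 -mulnDr leq_mul2l; apply/orP; right.
  by rewrite addn1 leq_subLR addnS ltnS -leq_subLR.
(* When [#|X'| <= im e] the truncated difference is 0 and the trivial bound by all subsets
   suffices. *)
have [leim|ltim] := leqP #|X'| (im e).
  have -> : (#|X'| - im e = 0)%N by apply/eqP; rewrite subn_eq0.
  rewrite muln0 expr0 mulr1 -[leRHS]mulr1; apply: ler_pM => //.
    by rewrite -natrX ler_nat card_traces_le.
  by rewrite -(expr0 th) th_anti.
have [z zX' npr] : exists2 z, z \in X' & ~~ has_private e X' Y' z.
  apply/exists_inP; apply: contraTT ltim; rewrite negb_exists_in => /forall_inP allpr.
  rewrite -leqNgt; apply: leq_trans (card_private_le_im Ge XYe X'X Y'Y).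
  apply/subset_leq_card/subsetP=> z zX'; rewrite inE zX'.
  by have := allpr z zX'; rewrite negbK.
have [P [zP PX' cP eqP]] := exists_block zX' npr.
(* With no hub, [z] has at most [K - 1] neighbours in [Y']; the block adds one vertex, [z]
   itself. *)
have {}cP : (#|P| <= K)%N.
  apply: leq_trans cP _; rewrite ltnNge; apply: contra nohub => hub.
  by apply/exists_inP; exists z.
have cX : #|X'| = (#|P| + #|X' :\: P|)%N by rewrite -(cardsID P X') (setIidPr PX').
have P0 : (0 < #|P|)%N by apply/card_gt0P; exists z.
have ltXk : (#|X' :\: P| < k)%N by apply: leq_trans leXk; rewrite cX -add1n leq_add2r.
have IH1 := IH _ _ ltXk (subset_trans (subsetDl _ _) X'X) Y'Y.
have neqP : P :\ z != P by apply: contraTneq zP => <-; rewrite setD11.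
have tr := card_traces_block PX' (subsetDl P [set z]) (subxx P) neqP (esym eqP).
set d := #|X' :\: P| in cX IH1; set p := #|P| in P0 cX cP tr.
(* The saved fraction is [2 ^- p], at least [2 ^- K]. The factor [th ^+ (K * K)] pays for the at
   most [K] units of [#|X'| - im e] lost with [P]. *)
have p2 : (2 ^ p).-1%:R <= 2 ^+ p * th ^+ (K * K) :> R.
  apply: le_trans _ (ler_wpM2l (exprn_ge0 _ _) blockK) => //.
  rewrite -subn1 natrB ?expn_gt0 // natrX mulrBr mulr1 lerB //.
  rewrite -(subnKC cP) exprD invfM mulrA divff ?expf_neq0 ?pnatr_eq0 // mul1r.
  by rewrite invf_le1 ?exprn_gt0 // exprn_ege1 // ler1n.
have {}tr : #|traces e X' Y'|%:R <= (2 ^ p).-1%:R * #|traces e (X' :\: P) Y'|%:R :> R.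
  by rewrite -natrM ler_nat.
apply: le_trans (ler_wpM2r (th_ge0 _) tr) _; rewrite -mulrA.
apply: le_trans (ler_pM _ _ p2 IH1) _; rewrite ?mulr_ge0 ?th_ge0 //.
rewrite mulrACA -!exprD cX; apply: ler_wpM2l; first by rewrite exprn_ge0.
apply: th_anti; rewrite -mulnDr leq_mul2l; apply/orP; right.
by rewrite leq_subLR addnCA leq_add // -leq_subLR.
Qed.

(** * The choice of [th] *)

Lemma bernoulli_le (R : realFieldType) (x : R) m :
  0 <= x -> x <= 1 -> 1 - m%:R * x <= (1 - x) ^+ m.
Proof.
move=> x0 x1; elim: m => [|m IH]; first by rewrite mul0r subr0 expr0.
rewrite exprSr; apply: le_trans _ (ler_wpM2r _ IH); last by rewrite subr_ge0.
rewrite -natr1; have : 0 <= m%:R * x * x by rewrite !mulr_ge0.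
lra.
Qed.

(** The subtracted term is chosen so that Bernoulli's inequality at exponent [K * K] loses exactly
    [2 ^- K]. As [K >= 2], this loss is at most 1/4, so [th ^+ K] is at least 3/4, where the cubic
    inequality holds. *)
Lemma saving_conditions (R : realFieldType) (K : nat) :
    (1 < K)%N -> let th : R := 1 - (2 ^+ K * (K * K)%:R)^-1 in
  [/\ 0 < th, th <= 1, 1 + th ^+ (3 * K) <= 2 * th ^+ K &
      1 - (2 ^+ K)^-1 <= th ^+ (K * K)].
Proof.
move=> K1 th; pose x : R := (2 ^+ K * (K * K)%:R)^-1.
have K2 : 2 <= K%:R :> R by rewrite (ler_nat R 2).
have KK0 : (K * K)%:R != 0 :> R by rewrite pnatr_eq0; lia.
have x0 : 0 < x by rewrite invr_gt0 mulr_gt0 ?exprn_gt0 // ltr0n; lia.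
have xKK : (K * K)%:R * x = (2 ^+ K)^-1.
  by rewrite /x invfM mulrCA divff // mulr1.
have pK : (2 ^+ K)^-1 <= 4^-1 :> R.
  rewrite lef_pV2 ?posrE ?exprn_gt0 // -(subnKC K1) exprD.
  have: 1 <= 2 ^+ (K - 2) :> R by rewrite exprn_ege1 // ler1n.
  lra.
have xK : K%:R * x <= 4^-1.
  apply: le_trans pK; rewrite -xKK ler_pM2r // ler_nat.
  by rewrite leq_pmulr // ltnW.
have xle : x <= 4^-1.
  by apply: le_trans xK; rewrite ler_peMl ?ltW //; lra.
have th0 : 0 < th by rewrite /th -/x; lra.
have th1 : th <= 1 by rewrite /th -/x; lra.
have bern m : 1 - m%:R * x <= th ^+ m by apply: bernoulli_le; lra.
split=> //; last by rewrite -xKK.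
rewrite mulnC exprM.
have := bern K; have : th ^+ K <= 1 by rewrite exprn_ile1 // ltW.
move: (th ^+ K) => a a1 ab.
(* [u ^ 3 - 2 u + 1 = (u - 1) (u ^ 2 + u - 1)], and u >= 3/4 *)
have : 0 <= (1 - a) * (a ^+ 2 + a - 1).
  apply: mulr_ge0; first by rewrite subr_ge0.
  have : 3 / 4 <= a by lra.
  nra.
rewrite exprS; nra.
Qed.

(** * Choice of constants and passage to logarithms *)

Theorem theorem1p5 (R : realType) :
  exists2 C : R, 0 < C &
    forall eps : R, 0 < eps ->
    exists2 delta : R, 2 `^ (- (C / eps)) <= delta &
      forall (T : finType) (e : rel T) (X Y : {set T}) (n : nat),
        simple_graph e -> bipartition e X Y ->
        #|X| = n -> #|Y| = (2 * n)%N ->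
        (im e)%:R < (1 - eps) * n%:R ->
        log2 (mis e)%:R < (1 - delta) * n%:R :> R.
Proof.
(* Below, [K * eps <= 8], so 24 makes [delta] at most [2 ^- (3 * K)], which is less than [x] because
   [K < 2 ^ K]. *)
exists 24 => // eps eps0; exists (2 `^ (- (24 / eps))) => //.
move=> T e X Y n Ge XYe cX cY im_lt.
have eps1 : eps < 1.
  rewrite -subr_gt0 ltNge; apply: contraTN im_lt => le0; rewrite -leNgt.
  exact: le_trans (mulr_le0_ge0 le0 (ler0n _ _)) (ler0n _ _).
have n0 : 0 < n%:R :> R.
  rewrite ltr0n lt0n; apply: contraTneq im_lt => ->.
  by rewrite mulr0 -leNgt ler0n.
(* The 7 is 6 + 1: the weight of [Y] costs exponent 3 * 2n = 6n, and n must remain. *)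
pose K := (Num.truncn (7 / eps)).+1.
have K_gt : 7 < K%:R * eps by rewrite -ltr_pdivrMr // truncnS_gt.
have K_le : K%:R * eps <= 8.
  have /andP[+ _] : (Num.truncn (7 / eps))%:R <= 7 / eps < K%:R.
    by apply: truncn_itv; rewrite divr_ge0 // ltW.
  have -> : K%:R = (Num.truncn (7 / eps))%:R + 1 :> R by rewrite natr1.
  rewrite ler_pdivlMr // mulrDl mul1r; lra.
have K1 : (1 < K)%N.
  rewrite -(ltr_nat R); have : 0 <= K%:R :> R by [].
  nra.
have [th0 th1 hubK blockK] := saving_conditions R K1.
set x := (2 ^+ K * (K * K)%:R)^-1 in th0 th1 hubK blockK.
set th := 1 - x in th0 th1 hubK blockK.
have expo : (7 * n <= K * (n - im e))%N.
  have imn : (im e <= n)%N.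
    rewrite -(ler_nat R); nra.
  rewrite -(ler_nat R) !natrM natrB //.
  have : 0 <= K%:R :> R by [].
  nra.
have mis_le : (mis e)%:R <= 2 ^+ n * th ^+ n.
  rewrite -(ler_pM2r (exprn_gt0 (3 * (2 * n)) th0)).
  apply: (@le_trans _ _ (#|traces e X Y|%:R * th ^+ (3 * (2 * n)))).
    by rewrite ler_pM2r ?exprn_gt0 // ler_nat mis_le_traces.
  rewrite -cY; apply: le_trans (card_traces_bound Ge XYe _ _ th0 th1 hubK blockK) _ => //.
  rewrite cX cY -mulrA -exprD ler_pM2l ?exprn_gt0 //.
  by apply: ler_wiXn2l => //; [exact: ltW|rewrite mulnA -mulSn].
have delta_lt : 2 `^ (- (24 / eps)) < x.
  apply: (@le_lt_trans _ _ (2 ^+ (3 * K))^-1).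
    rewrite powRN lef_pV2 ?posrE ?powR_gt0 ?exprn_gt0 // -powR_mulrn //.
    apply: ler_powR; first by rewrite ler1n.
    by rewrite ler_pdivlMr // natrM; lra.
  rewrite ltf_pV2 ?posrE ?mulr_gt0 ?exprn_gt0 ?ltr0n ?muln_gt0 //.
  rewrite -natrX -natrM -natrX ltr_nat mulSn mul2n -addnn !expnD ltn_pmul2l ?expn_gt0 //.
  by apply: ltn_mul; apply: ltn_expl.
have ln2_gt0 : 0 < ln 2 :> R by rewrite ln_gt0 // ltr1n.
(* Since ln(1 - x) <= -x, it remains to compare [ln 2 - x] with [(1 - delta) * ln 2]; this follows
   from [delta < x] and [ln 2 <= 1]. *)
have ln2_le1 : ln 2 <= 1 :> R by apply: (@le_ln1Dx R 1); lra.
rewrite /log2 ltr_pdivrMr //.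
set delta := 2 `^ _ in delta_lt *.
have delta0 : 0 < delta by apply: powR_gt0.
(* As [ln 0] is 0 by convention, this case only asks for a positive right-hand side, given by
   [delta < x < 1]. *)
have [->|mis0] := posnP (mis e).
  by rewrite ln0 // !mulr_gt0 // subr_gt0; rewrite /th in th0; lra.
apply: (@le_lt_trans _ _ ((ln 2 - x) * n%:R)).
  apply: (@le_trans _ _ (ln ((2 * th) ^+ n))).
    by rewrite exprMn ler_ln ?posrE ?ltr0n ?mulr_gt0 ?exprn_gt0.
  rewrite lnXn ?mulr_gt0 // -[ln _ *+ n]mulr_natr ler_pM2r // lnM ?posrE // lerD2l.
  by apply: le_ln1Dx; rewrite /th in th0; lra.
rewrite mulrAC ltr_pM2r //.
nra.
Qed.
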